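(* Let $X$ be a $d$-box. Then the functions $\eta_B$ restricted to the set of proper boxes of $X$, for $B$ ranging over all boxes of $X$ of odd size, form a basis of the real vector space $\mathbf{A}(X,\mathbb{R})$ of additive functions on proper boxes of $X$.
   Context: A $d$-box is $X=X_1\times\cdots\times X_d$ with finite nonempty sets $X_i$. A box is a nonempty $A_1\times\cdots\times A_d$ with $A_i\subseteq X_i$, proper if $A_i\neq X_i$ for all $i$. Two boxes $A,B$ form a twin pair if for some $i$, $A_j=B_j$ for all $j\neq i$ and $A_i=X_i\setminus B_i$. A function $f$ from the set of proper boxes of $X$ to $\mathbb{R}$ is additive if for any two twin pairs $A,B$ and $C,D$ of proper boxes with $A\cup B=C\cup D$ we have $f(A)+f(B)=f(C)+f(D)$; $\mathbf{A}(X,\mathbb{R})$ denotes the space of these functions. For a box $B$ of odd size, $\eta_B(A)=1$ if $|A\cap B|$ is odd and $0$ otherwise.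
   Formalization: Every X_i is assumed to have at least two elements; if some X_i is a singleton there are no proper boxes, so A(X,R) is zero while boxes of odd size still exist, and the claim fails. *)

(* Defs.v *)
From HB Require Import structures.
From mathcomp Require Import all_boot all_order all_algebra.
From mathcomp Require Import reals.

Set Implicit Arguments.
Unset Strict Implicit.
Unset Printing Implicit Defensive.

Import GRing.Theory.
Local Open Scope ring_scope.

Section Boxes.
Variables (d : nat) (X : 'I_d -> finType).

(* The family of sides (A_i) of a would-be box; a nonempty product determines
   its sides, so boxes are represented by their sides and [box_set] gives the
   actual subset of X_1 x ... x X_d. *)
Definition sides := {dffun forall i : 'I_d, {set X i}}.

Definition box_set (A : sides) : {set {dffun forall i : 'I_d, X i}} := setXn A.

Definition is_box (A : sides) : bool := box_set A != set0.

Definition is_proper (A : sides) : bool := [forall i, A i != [set: X i]].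

Definition proper_box := {A : sides | is_box A && is_proper A}.

Definition odd_box := {B : sides | is_box B && odd #|box_set B|}.

Definition twin (A B : sides) : bool :=
  [exists i, [forall j, (j != i) ==> (A j == B j)] && (A i == ~: B i)].

Variable R : realType.

(* R^o is R regarded as a vector space over itself. *)
Definition box_fun := {ffun proper_box -> R^o}.

Definition additive_box_fun (f : box_fun) : Prop :=
  forall A B C D : proper_box,
    twin (val A) (val B) -> twin (val C) (val D) ->
    box_set (val A) :|: box_set (val B) = box_set (val C) :|: box_set (val D) ->
    f A + f B = f C + f D.

Definition twin_quad (q : proper_box * proper_box * proper_box * proper_box) :=
  let: (A, B, C, D) := q in
  [&& twin (val A) (val B), twin (val C) (val D) &
      box_set (val A) :|: box_set (val B)
        == box_set (val C) :|: box_set (val D)].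

Definition twin_defect (q : proper_box * proper_box * proper_box * proper_box)
    (f : box_fun) : R^o :=
  let: (A, B, C, D) := q in f A + f B - (f C + f D).

Fact twin_defect_linear q : linear (twin_defect q).
Proof.
case: q => [[[A B] C] D] a f g; rewrite /twin_defect !ffunE !scalerBr !scalerDr.
by rewrite !opprD !addrA [LHS](ACl (1*3*5*7*2*4*6*8))%AC.
Qed.

HB.instance Definition _ q :=
  GRing.isLinear.Build R box_fun R^o _ (twin_defect q) (twin_defect_linear q).

(* The space A(X, R), built as the solution space of the equations defining
   additivity; [additive_spaceP] is its characterization. *)
Definition additive_space : {vspace box_fun} :=
  (\bigcap_(q | twin_quad q) lker (linfun (twin_defect q)))%VS.

Lemma additive_spaceP (f : box_fun) :
  reflect (additive_box_fun f) (f \in additive_space).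
Proof.
apply: (iffP subv_bigcapP) => [H A B C D tAB tCD eU | H [[[A B] C] D]].
  have /= := H (A, B, C, D); rewrite tAB tCD eU eqxx => /(_ isT).
  by rewrite -memvE memv_ker lfunE /= subr_eq0 => /eqP.
move=> /and3P[tAB tCD /eqP eU].
by rewrite -memvE memv_ker lfunE /= subr_eq0; apply/eqP/H.
Qed.

Definition eta_fun (B : odd_box) : box_fun :=
  [ffun A : proper_box =>
     (odd #|box_set (val A) :&: box_set (val B)|)%:R : R^o].

End Boxes.

Arguments eta_fun {d X} R B.

(* Main.v *)
(** Each [eta_B] is a product over the coordinates, and for a twin pair [A, A']
    the values [eta_B A] and [eta_B A'] are never both [1], so that their sum is
    the parity of [(A ∪ A') ∩ B]; hence [eta_B] is additive.

    Independence: by the same identity a relation between the [eta_B] that holds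
    on proper boxes holds for all families of sides.  The Fourier functional
    [f |-> sum_A (-1)^(sum_i |A_i ∩ B_i|) f A] kills every [eta_B'] with
    [B' != B]: choose [i] and [T] with [|T ∩ B'_i|] even and [|T ∩ B_i|] odd, and
    toggle [T] in [A_i].  It does not kill [eta_B].

    Dimension: fix [x_i] in each [X_i].  Since
    [f(.., S, ..) = f(.., {x_i}, ..) + f(.., ~{x_i}, ..) - f(.., ~S, ..)], an
    additive function is determined by the boxes each side of which avoids [x_i]
    or equals [{x_i}].  Toggling the membership of [x_i] to make the size odd
    puts these boxes in bijection with the odd boxes. *)
Require Import Defs.
From HB Require Import structures.
From mathcomp Require Import all_boot all_order all_algebra.
From mathcomp Require Import reals.

Set Implicit Arguments.
Unset Strict Implicit.
Unset Printing Implicit Defensive.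

Import GRing.Theory Num.Theory.

(** * Parity of intersections under symmetric difference *)

Section Toggle.
Variable T : finType.
Implicit Types A B S : {set T}.

(** Symmetric difference, that is, translation by [S] in the F_2-space of subsets of [T]. *)
Definition toggle S A : {set T} := [set x | (x \in A) (+) (x \in S)].

Lemma toggleK S : involutive (toggle S).
Proof. by move=> A; apply/setP => x; rewrite !inE addbK. Qed.

Lemma odd_cardI A B : odd #|A :&: B| = \big[addb/false]_(x in B) (x \in A).
Proof.
rewrite -sum1_card (big_morph odd oddD (erefl _)) /=.
under eq_bigl do rewrite inE andbC.
by rewrite big_mkcondr; apply: eq_bigr => x _; case: (x \in A).
Qed.

Lemma odd_toggleI S A B :
  odd #|toggle S A :&: B| = odd #|A :&: B| (+) odd #|S :&: B|.
Proof.
by rewrite !odd_cardI -big_split; apply: eq_bigr => x _; rewrite inE.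
Qed.

(** Over F_2, [C] is neither zero nor [B], hence not a multiple of [B], so some linear form vanishes
    at [B] but not at [C]. *)
Lemma separating_set B C : B != C -> odd #|B| -> odd #|C| ->
  exists S, ~~ odd #|S :&: B| && odd #|S :&: C|.
Proof.
move=> neqBC oB oC.
have [/subsetP sCB | /subsetPn[x xC xnB]] := boolP (C \subset B); last first.
  by exists [set x]; rewrite ![[set x] :&: _]setIC !odd_cardI !big_set1 xnB.
have [x xC] : exists x, x \in C.
  by apply/set0Pn; apply: contraTneq oC => ->; rewrite cards0.
have /subsetPn[y yB ynC] : ~~ (B \subset C).
  by apply: contra neqBC => sBC; rewrite eqEsubset sBC; apply/subsetP.
have neqxy : x != y by apply: contraNneq ynC => <-.
(* Here [C] is strictly inside [B]: the pair has both points in [B] and only [x] in [C]. *)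
exists [set x; y]; rewrite ![[set x; y] :&: _]setIC !odd_cardI.
by rewrite !big_setU1 ?inE //= !big_set1 sCB // yB xC (negPf ynC).
Qed.

End Toggle.

Lemma free_codom (K : fieldType) (vT : vectType K) (I : finType) (F : I -> vT) :
    (forall k : I -> K, (\sum_i k i *: F i = 0)%R -> forall i, k i = 0%R) ->
  free [seq F i | i : I].
Proof.
move=> indepF; rewrite -[X in free X]/(val (codom_tuple F)).
apply/freeP => k sum0 i.
rewrite -[i]enum_valK; apply: (indepF (k \o enum_rank)).
rewrite -[RHS]sum0 (reindex enum_rank); last exact/onW_bij/enum_rank_bij.
apply: eq_bigr => j _ /=; congr (_ *: _)%R.
by rewrite nth_codom enum_rankK.
Qed.

(** * Boxes, twin pairs and parities *)

Section Boxes.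
Variables (d : nat) (X : 'I_d -> finType).
Implicit Types A B C : sides X.

Lemma is_boxE A : is_box A = [forall i, A i != set0].
Proof.
rewrite /is_box -card_gt0 /box_set cardsXn.
rewrite (big_morph (leq 1) muln_gt0 (erefl _)) big_andE.
by apply: eq_forallb => i; rewrite card_gt0.
Qed.

Lemma proper_boxP A :
  reflect (forall i, A i != set0 /\ A i != [set: X i]) (is_box A && is_proper A).
Proof.
rewrite is_boxE; apply: (iffP andP) => [[/forallP A0 /forallP AT] // | AP].
by split; apply/forallP => i; case: (AP i).
Qed.

Lemma odd_box_setI A B :
  odd #|box_set A :&: box_set B| = [forall i, odd #|A i :&: B i|].
Proof.
have -> : box_set A :&: box_set B = setXn (fun i => A i :&: B i).
  apply/setP => x; rewrite inE; apply/andP/setXnP => [[xA xB] i | xAB].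
    by rewrite inE (setXnP xA) (setXnP xB).
  by split; apply/setXnP => i; case/setIP: (xAB i).
by rewrite cardsXn (big_morph odd oddM (erefl _)) big_andE.
Qed.

Lemma odd_boxP B :
  reflect (forall i, odd #|B i|) (is_box B && odd #|box_set B|).
Proof.
rewrite -[box_set B]setIid odd_box_setI is_boxE.
apply: (iffP andP) => [[_ /forallP oB] i | oB]; first by rewrite -[B i]setIid.
split; apply/forallP => i; last by rewrite setIid.
by apply: contraTneq (oB i) => ->; rewrite cards0.
Qed.

Definition upd A i (S : {set X i}) : sides X := finfun (dfwith A S).

Lemma upd_in A i (S : {set X i}) : upd A S i = S.
Proof. by rewrite ffunE dfwith_in. Qed.

Lemma upd_out A i (S : {set X i}) j : i != j -> upd A S j = A j.
Proof. by move=> neqij; rewrite ffunE dfwith_out. Qed.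

Lemma upd_id A i : upd A (A i) = A.
Proof.
apply/ffunP => j; have [<-|neqij] := eqVneq i j; first by rewrite upd_in.
by rewrite upd_out.
Qed.

Lemma updK A i (S S' : {set X i}) : upd (upd A S) S' = upd A S'.
Proof.
apply/ffunP => j; have [<-|neqij] := eqVneq i j; first by rewrite !upd_in.
by rewrite !upd_out.
Qed.

Lemma twin_upd A i (S : {set X i}) : twin (upd A S) (upd A (~: S)).
Proof.
apply/existsP; exists i; rewrite !upd_in setCK eqxx andbT.
by apply/forallP => j; apply/implyP; rewrite eq_sym => neqij; rewrite !upd_out.
Qed.

(** The union is independent of [S], so any two splittings along the same coordinate can be compared
    by additivity. *)
Lemma box_set_updU A i (S : {set X i}) :
  box_set (upd A S) :|: box_set (upd A (~: S)) = box_set (upd A [set: X i]).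
Proof.
have in_upd (S' : {set X i}) x :
    (x \in box_set (upd A S')) =
    (x i \in S') && [forall j, (i != j) ==> (x j \in A j)].
  apply/setXnP/andP => [xA | [xS /forallP xA] j].
    split; first by have := xA i; rewrite upd_in.
    apply/forallP => j; apply/implyP => neqij.
    by have := xA j; rewrite upd_out.
  have [<-|neqij] := eqVneq i j; first by rewrite upd_in.
  by rewrite upd_out //; have := xA j; rewrite neqij.
by apply/setP => x; rewrite inE !in_upd !inE -andb_orl orbN.
Qed.

(** Along the coordinate [i] where the twins are complementary, the two intersections with [B i]
    have sizes adding up to the odd number [#|B i|], so they cannot both be odd. *)
Lemma twin_parity (R : nzRingType) A A' B : (forall i, odd #|B i|) -> twin A A' ->
  ((odd #|box_set A :&: box_set B|)%:R + (odd #|box_set A' :&: box_set B|)%:R =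
   (odd #|(box_set A :|: box_set A') :&: box_set B|)%:R :> R)%R.
Proof.
move=> oB /existsP[i /andP[_ /eqP eqAi]].
rewrite setIUl cardsU.
have -> : box_set A :&: box_set B :&: (box_set A' :&: box_set B) = set0.
  apply/setP => x; rewrite in_set0; apply/negP => /setIP[/setIP[xA _] /setIP[xA' _]].
  by have := setXnP xA i; rewrite eqAi inE (setXnP xA').
rewrite cards0 subn0 oddD.
suff : ~~ (odd #|box_set A :&: box_set B| && odd #|box_set A' :&: box_set B|).
  by do 2!case: odd => //=; rewrite ?addr0 ?add0r.
rewrite !odd_box_setI; apply/negP => /andP[/forallP/(_ i) oA /forallP/(_ i) oA'].
have := oB i; rewrite -(cardsID (A' i) (B i)) oddD setIC oA' setDE -eqAi.
by rewrite setIC oA.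
Qed.

(** * Fourier functionals evaluated on the parity functions *)

Lemma sum_eta_neq (R : numDomainType) B C :
    (forall i, odd #|B i|) -> (forall i, odd #|C i|) -> B != C ->
  (\sum_(A : sides X) (-1) ^+ (\sum_i #|A i :&: C i|) *
     (odd #|box_set A :&: box_set B|)%:R = 0 :> R)%R.
Proof.
move=> oB oC neqBC.
have [i neqi] : exists i, B i != C i.
  apply/existsP; rewrite -negb_forall; apply: contra neqBC => /forallP eqBC.
  by apply/eqP/ffunP => i; apply/eqP.
have [S /andP[evS oS]] := separating_set neqi (oB i) (oC i).
pose tog A := upd A (toggle S (A i)).
have togK : involutive tog.
  by move=> A; rewrite /tog updK upd_in toggleK upd_id.
set s := (\sum_A _)%R.
(* Toggling by [S] keeps the parity with [B i] and flips the one with [C i]: each term only changes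
   sign, so the sum is its own opposite. *)
suff /eqP : s = (- s)%R by rewrite -addr_eq0 -mulr2n mulrn_eq0 => /eqP.
rewrite {1}/s (reindex_inj (inv_inj togK)) /= -sumrN; apply: eq_bigr => A _.
rewrite !odd_box_setI -mulNr.
have -> : [forall j, odd #|tog A j :&: B j|] = [forall j, odd #|A j :&: B j|].
  apply: eq_forallb => j; have [<-|neqij] := eqVneq i j; last by rewrite upd_out.
  by rewrite upd_in odd_toggleI (negPf evS) addbF.
congr (_ * _)%R; rewrite -signr_odd -[in RHS]signr_odd.
rewrite (bigD1 i) //= [in RHS](bigD1 i) //= upd_in.
under eq_bigr => j neqji do rewrite upd_out 1?eq_sym //.
by rewrite !oddD odd_toggleI oS addbT addNb signrN.
Qed.

(** A term survives only if every [#|A i :&: B i|] is odd, and then its sign is [(-1) ^+ d]. Nothing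
    cancels, and [A = B] contributes. *)
Lemma sum_eta_eq (R : numDomainType) B : (forall i, odd #|B i|) ->
  (\sum_(A : sides X) (-1) ^+ (\sum_i #|A i :&: B i|) *
     (odd #|box_set A :&: box_set B|)%:R != 0 :> R)%R.
Proof.
move=> oB; pose n := \sum_(A : sides X) odd #|box_set A :&: box_set B|.
have -> : (\sum_(A : sides X) (-1) ^+ (\sum_i #|A i :&: B i|) *
     (odd #|box_set A :&: box_set B|)%:R = (-1) ^+ d * n%:R :> R)%R.
  rewrite natr_sum mulr_sumr; apply: eq_bigr => A _; rewrite odd_box_setI.
  case: forallP => [oA|]; last by rewrite !mulr0.
  congr (_ * _)%R; rewrite -signr_odd -[in RHS]signr_odd; congr (_ ^+ _)%R.
  have -> : odd d = odd (\sum_(i < d) 1) by rewrite sum1_card card_ord.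
  rewrite !(big_morph odd oddD (erefl _)).
  by congr nat_of_bool; apply: eq_bigr => i _; rewrite oA.
rewrite mulf_neq0 ?signr_eq0 // pnatr_eq0 -lt0n /n (bigD1 B) //= odd_box_setI.
have -> // : [forall i, odd #|B i :&: B i|].
by apply/forallP => i; rewrite setIid.
Qed.

(** * Independence and additivity when every side has at least two points *)

Section Large.
Hypothesis hX : forall i : 'I_d, 1 < #|X i|.
Variable R : realType.

Lemma setC1_neq0 i (x : X i) : ~: [set x] != set0.
Proof. by rewrite -card_gt0 cardsC1 -subn1 subn_gt0. Qed.

Lemma set1_neqT i (x : X i) : [set x] != [set: X i].
Proof. by rewrite -setC0 -[[set x]]setCK (inj_eq (@setC_inj _)) setC1_neq0. Qed.

Definition base_point i : X i := enum_val (Ordinal (ltnW (hX i))).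

(* A full side is split into [{x}] and its complement, both proper. *)
Lemma parity_combination_eq0 (k : odd_box X -> R) :
    (forall A, is_box A && is_proper A ->
      \sum_B k B * (odd #|box_set A :&: box_set (val B)|)%:R = 0)%R ->
  forall A, (\sum_B k B * (odd #|box_set A :&: box_set (val B)|)%:R = 0)%R.
Proof.
(* Induction on the number of full sides, which drops when a full side is replaced by a proper
   subset. *)
move=> k0 A; have [n] := ubnP #|[pred i | A i == setT]|.
elim: n A => // n IHn A; rewrite ltnS => leAn.
have [|nA] := boolP (is_box A); last first.
  (* A family with an empty side meets every [B] in the empty set, so all terms vanish. *)
  rewrite big1 // => B _; rewrite odd_box_setI.
  case: forallP => [oA|]; last by rewrite mulr0.
  case/negP: nA; rewrite is_boxE; apply/forallP => i.
  by apply: contraTneq (oA i) => ->; rewrite set0I cards0.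
have [pA bA|] := boolP (is_proper A); first by rewrite k0 ?bA.
rewrite negb_forall => /existsP[i]; rewrite negbK => /eqP AiT _.
pose S := [set base_point i].
have IH (S' : {set X i}) : S' != setT ->
    (\sum_B k B * (odd #|box_set (upd A S') :&: box_set (val B)|)%:R = 0)%R.
  move=> S'T; apply: IHn; apply: leq_trans leAn; apply: proper_card.
  apply/properP; split; last by exists i; rewrite !inE ?AiT // upd_in.
  apply/subsetP => j; rewrite !inE; have [<-|neqij] := eqVneq i j.
    by rewrite AiT eqxx.
  by rewrite upd_out.
rewrite -[A](upd_id A i) AiT -(box_set_updU A S).
have ST : S != setT by apply: set1_neqT.
have CST : ~: S != setT.
  by rewrite -setC0 (inj_eq (@setC_inj _)) -card_gt0 cards1.
have := congr2 +%R (IH _ ST) (IH _ CST).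
rewrite addr0 -big_split /= => sum0; rewrite -[RHS]sum0.
apply: eq_bigr => B _; rewrite -mulrDr twin_parity ?twin_upd //.
exact/odd_boxP/(valP B).
Qed.

Lemma eta_fun_free : free [seq eta_fun R B | B : odd_box X].
Proof.
apply: free_codom => k /ffunP sum0 B0.
(* The Fourier functional sums over all families of sides, so the relation must first be extended
   beyond proper boxes. *)
have k0 : forall A, (\sum_B k B * (odd #|box_set A :&: box_set (val B)|)%:R = 0)%R.
  apply: parity_combination_eq0 => A pA.
  have := sum0 (Sub A pA); rewrite sum_ffunE !ffunE => s0; rewrite -[RHS]s0.
  by apply: eq_bigr => B _; rewrite !ffunE SubK.
have oB (B : odd_box X) := odd_boxP _ (valP B).
have : (\sum_(A : sides X) (-1) ^+ (\sum_i #|A i :&: val B0 i|) *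
     (\sum_B k B * (odd #|box_set A :&: box_set (val B)|)%:R) = 0)%R.
  by apply: big1 => A _; rewrite k0 mulr0.
under eq_bigr do rewrite mulr_sumr; rewrite exchange_big /=.
under eq_bigr => B _ do (under eq_bigr do rewrite mulrCA; rewrite -mulr_sumr).
rewrite (bigD1 B0) //= [X in (_ + X)%R]big1 => [|B neqB]; last first.
  by rewrite sum_eta_neq ?mulr0 //; apply: oB.
rewrite addr0 => /eqP; rewrite mulf_eq0 (negPf (sum_eta_eq _ (oB B0))).
by rewrite orbF => /eqP.
Qed.

Lemma eta_fun_additive (B : odd_box X) : eta_fun R B \in additive_space X R.
Proof.
apply/additive_spaceP => A A' C C' tA tC eqU; have oB := odd_boxP _ (valP B).
by rewrite !ffunE !twin_parity // eqU.
Qed.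

(** * Reduced boxes and the dimension bound *)

Definition reduced i (S : {set X i}) :=
  (base_point i \notin S) || (S == [set base_point i]).

Lemma additive_eq0 (f : box_fun X R) : additive_box_fun f ->
    (forall A : proper_box X, (forall i, reduced (val A i)) -> f A = 0%R) ->
  f = 0%R.
Proof.
move=> addf f0; apply/ffunP => A; rewrite ffunE.
(* Induction on the number of sides that are not reduced. *)
have [n] := ubnP #|[pred i | ~~ reduced (val A i)]|.
elim: n A => // n IHn A; rewrite ltnS => leAn.
have [/forallP/f0 // | ] := boolP [forall i, reduced (val A i)].
rewrite negb_forall => /existsP[i nri]; have /proper_boxP pA := valP A.
set x := base_point i.
have xA : x \in val A i by move: nri; rewrite negb_or negbK => /andP[].
have updP (S : {set X i}) : S != set0 -> S != setT ->
    is_box (upd (val A) S) && is_proper (upd (val A) S).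
  move=> S0 ST; apply/proper_boxP => j.
  by have [<-|neqij] := eqVneq i j; rewrite ?upd_in // upd_out.
pose pb S S0 ST : proper_box X := Sub (upd (val A) S) (updP S S0 ST).
have IH S S0 ST : reduced S -> f (@pb S S0 ST) = 0%R.
  move=> rS; apply: IHn; apply: leq_trans leAn; apply: proper_card.
  apply/properP; split; last by exists i; rewrite !inE ?nri // upd_in rS.
  apply/subsetP => j; rewrite !inE; have [<-|neqij] := eqVneq i j.
    by rewrite nri.
  by rewrite upd_out.
have CT (S : {set X i}) : S != set0 -> ~: S != setT.
  by rewrite -setC0 (inj_eq (@setC_inj _)).
have C0 (S : {set X i}) : S != setT -> ~: S != set0.
  by rewrite -setCT (inj_eq (@setC_inj _)).
have x0 : [set x] != set0 by rewrite -card_gt0 cards1.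
have [A0 AT] := pA i.
have := twin_upd (val A) (val A i); rewrite upd_id => tA.
have := box_set_updU (val A) (val A i); rewrite upd_id => eqU.
(* Both pairs split [A] with side [i] made full. The three boxes other than [A] have a reduced side
   [i] and agree with [A] elsewhere, so induction applies to them. *)
have := addf A (pb _ (C0 _ AT) (CT _ A0))
  (pb _ x0 (set1_neqT x)) (pb _ (setC1_neq0 x) (CT _ x0))
  tA (twin_upd _ _) (etrans eqU (esym (box_set_updU _ _))).
rewrite !IH ?addr0 //.
- by rewrite /reduced !inE eqxx.
- by rewrite /reduced eqxx orbT.
- by rewrite /reduced inE xA.
Qed.

(** Goes from odd boxes to reduced ones. A singleton side at the base point is kept, since deleting
    its point would leave the empty set. *)
Definition reduce (B : sides X) : sides X :=
  finfun (fun i => if B i == [set base_point i] then B i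
                   else B i :\ base_point i).

Lemma reduce_proper (B : odd_box X) :
  is_box (reduce (val B)) && is_proper (reduce (val B)).
Proof.
apply/proper_boxP => i; have oB := odd_boxP _ (valP B) i; rewrite ffunE.
case: (eqVneq (val B i)) => [->|neqB].
  by split; [rewrite -card_gt0 cards1 | apply: set1_neqT].
split; last first.
  by apply/eqP => /setP/(_ (base_point i)); rewrite !inE eqxx.
apply: contra neqB; rewrite setD_eq0 subset1 => /orP[] // /eqP B0.
by rewrite B0 cards0 in oB.
Qed.

Definition reduce_box (B : odd_box X) : proper_box X :=
  Sub (reduce (val B)) (reduce_proper B).

Lemma reduced_codom (A : proper_box X) : (forall i, reduced (val A i)) ->
  exists B : odd_box X, A = reduce_box B.
Proof.
move=> rA; have /proper_boxP pA := valP A.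
(* An even reduced side is not a singleton, so it avoids the base point, and adding that point makes
   it odd. *)
pose C : sides X := finfun (fun i =>
  if odd #|val A i| then val A i else base_point i |: val A i).
have oC : is_box C && odd #|box_set C|.
  apply/odd_boxP => i; rewrite ffunE; case: ifPn => // evA.
  have := rA i; rewrite /reduced => /orP[xA | /eqP eqA].
    by rewrite cardsU1 xA add1n.
  by rewrite eqA cards1 in evA.
exists (Sub C oC : odd_box X); apply/val_inj/ffunP => i; rewrite /= !ffunE.
have [A0 _] := pA i; have /orP[xA | /eqP eqA] := rA i; last first.
  have -> : odd #|val A i| by rewrite eqA cards1.
  by rewrite eqA eqxx.
have AD : val A i :\ base_point i = val A i.
  apply/setP => y; rewrite !inE; case: eqVneq => // ->.
  by rewrite (negPf xA).
have nA1 : val A i != [set base_point i].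
  by apply: contraNneq xA => ->; rewrite inE.
case: odd; first by rewrite (negPf nA1) AD.
(* The enlarged side is not the singleton, because [val A i] is nonempty and avoids the base
   point. *)
rewrite setU1K //; case: eqVneq => // /setP eqA.
have /set0Pn[y yA] := A0; have := eqA y; rewrite !inE yA orbT => /esym/eqP yx.
by rewrite -yx yA in xA.
Qed.

Definition restriction (f : box_fun X R) : {ffun odd_box X -> R^o} :=
  [ffun B => f (reduce_box B)].

Fact restriction_linear : linear restriction.
Proof. by move=> a f g; apply/ffunP => B; rewrite !ffunE. Qed.

HB.instance Definition _ :=
  GRing.isLinear.Build R (box_fun X R) {ffun odd_box X -> R^o} _
    restriction restriction_linear.

Lemma dim_additive_space : \dim (additive_space X R) <= #|{: odd_box X}|.
Proof.
(* Restriction is injective on additive functions, as every reduced box is some [reduce_box B]; the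
   target has dimension the number of odd boxes. *)
rewrite -(@limg_dim_eq _ _ _ (linfun restriction)); last first.
  apply/eqP; rewrite -subv0; apply/subvP => f.
  rewrite memv_cap memv_ker lfunE memv0 => /andP[/additive_spaceP addf /eqP rf0].
  apply/eqP/additive_eq0 => // A /reduced_codom[B ->].
  by have /ffunP/(_ B) := rf0; rewrite !ffunE.
apply: leq_trans (dimvS (subvf _)) _.
by rewrite dimvf /dim /= muln1.
Qed.

End Large.
End Boxes.

Theorem theorem3p5 (R : realType) (d : nat) (X : 'I_d -> finType)
  (hX : forall i : 'I_d, 1 < #|X i|) :
  basis_of (additive_space X R) [seq eta_fun R B | B : odd_box X].
Proof.
(* A free family inside a space whose dimension is at most its size is a basis. *)
rewrite basisEfree eta_fun_free // size_codom dim_additive_space // andbT.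
by apply/span_subvP => _ /codomP[B ->]; apply: eta_fun_additive.
Qed.
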